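(* Let $\mathfrak{F}$ be the family of isomorphism classes of the $L$-modules $\Bbbk_a$, $\mathcal{U}_{a,b}$, $\mathcal{W}_a$, $a,b\in\Bbbk^{\times}$. Then $\operatorname{rep}_{\mathfrak{F}}L$ is a monoidal subcategory of $\operatorname{rep}L$.
   Context: $\Bbbk$ is an algebraically closed field of characteristic $0$. $L$ is the Hopf algebra generated as an algebra by $y$ and $g^{\pm 1}$ with relations $gg^{-1}=g^{-1}g=1$, $gyg^{-1}=-y$, and comultiplication $\Delta(g)=g\otimes g$, $\Delta(y)=y\otimes 1+g\otimes y$. $\operatorname{rep}L$ is the monoidal category of finite-dimensional left $L$-modules. For $a,b\in\Bbbk^\times$: $\Bbbk_a=\Bbbk$ with $y\cdot1=0$, $g\cdot 1=a$; $\mathcal{U}_{a,b}=\Bbbk^2$ with $g\mapsto \begin{pmatrix} a&0\\0&-a\end{pmatrix}$, $y\mapsto \begin{pmatrix}0&b\\1&0\end{pmatrix}$; $\mathcal{W}_a=\Bbbk^2$ with $g\mapsto \begin{pmatrix} a&0\\0&-a\end{pmatrix}$, $y\mapsto \begin{pmatrix}0&1\\0&0\end{pmatrix}$. These modules are indecomposable. For a family $\mathfrak{F}$ of isomorphism classes of indecomposable modules, $\operatorname{rep}_{\mathfrak{F}}L$ is the full subcategory of $\operatorname{rep}L$ whose objects are the (finite) direct sums of representatives of $\mathfrak{F}$, i.e. the modules all of whose indecomposable components belong to $\mathfrak{F}$. *)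

(* Defs.v *)
From HB Require Import structures.
From mathcomp Require Import all_boot all_order all_algebra.
From mathcomp Require Import boolp.
From mathcomp Require Import mxtens.

Set Implicit Arguments.
Unset Strict Implicit.
Unset Printing Implicit Defensive.

Import GRing.Theory.
Local Open Scope ring_scope.
Local Open Scope quotient_scope.

Record category := Category {
  cat_ob :> Type;
  cat_hom : cat_ob -> cat_ob -> Type;
  cat_id : forall a, cat_hom a a;
  cat_comp : forall a b c, cat_hom b c -> cat_hom a b -> cat_hom a c;
  cat_compA : forall a b c d (h : cat_hom c d) (g : cat_hom b c)
    (f : cat_hom a b), cat_comp h (cat_comp g f) = cat_comp (cat_comp h g) f;
  cat_comp1l : forall a b (f : cat_hom a b), cat_comp (cat_id b) f = f;
  cat_comp1r : forall a b (f : cat_hom a b), cat_comp f (cat_id a) = f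
}.
Notation "g \oc f" := (cat_comp g f) (at level 50, left associativity).

Record cat_iso (C : category) (a b : C) := CatIso {
  iso_fwd : cat_hom a b;
  iso_bwd : cat_hom b a;
  iso_bwdK : iso_bwd \oc iso_fwd = cat_id a;
  iso_fwdK : iso_fwd \oc iso_bwd = cat_id b
}.

Record monoidal_category := MonoidalCategory {
  mon_cat :> category;
  mon_ob : mon_cat -> mon_cat -> mon_cat;
  mon_hom : forall a a' b b' : mon_cat, cat_hom a a' -> cat_hom b b' ->
    cat_hom (mon_ob a b) (mon_ob a' b');
  mon_unit : mon_cat;
  mon_assoc : forall a b c : mon_cat,
    cat_iso (mon_ob (mon_ob a b) c) (mon_ob a (mon_ob b c));
  mon_lunit : forall a : mon_cat, cat_iso (mon_ob mon_unit a) a;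
  mon_runit : forall a : mon_cat, cat_iso (mon_ob a mon_unit) a;
  mon_hom_id : forall a b, mon_hom (cat_id a) (cat_id b) = cat_id (mon_ob a b);
  mon_hom_comp : forall a a' a'' b b' b'' (f' : cat_hom a' a'')
    (f : cat_hom a a') (g' : cat_hom b' b'') (g : cat_hom b b'),
    mon_hom (f' \oc f) (g' \oc g) = mon_hom f' g' \oc mon_hom f g;
  mon_assoc_nat : forall a a' b b' c c' (f : cat_hom a a') (g : cat_hom b b')
    (h : cat_hom c c'),
    mon_hom f (mon_hom g h) \oc iso_fwd (mon_assoc a b c)
    = iso_fwd (mon_assoc a' b' c') \oc mon_hom (mon_hom f g) h;
  mon_lunit_nat : forall a a' (f : cat_hom a a'),
    f \oc iso_fwd (mon_lunit a)
    = iso_fwd (mon_lunit a') \oc mon_hom (cat_id mon_unit) f;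
  mon_runit_nat : forall a a' (f : cat_hom a a'),
    f \oc iso_fwd (mon_runit a)
    = iso_fwd (mon_runit a') \oc mon_hom f (cat_id mon_unit);
  mon_pentagon : forall a b c d,
    iso_fwd (mon_assoc a b (mon_ob c d))
      \oc iso_fwd (mon_assoc (mon_ob a b) c d)
    = mon_hom (cat_id a) (iso_fwd (mon_assoc b c d))
      \oc iso_fwd (mon_assoc a (mon_ob b c) d)
      \oc mon_hom (iso_fwd (mon_assoc a b c)) (cat_id d);
  mon_triangle : forall a b,
    mon_hom (cat_id a) (iso_fwd (mon_lunit b))
      \oc iso_fwd (mon_assoc a mon_unit b)
    = mon_hom (iso_fwd (mon_runit a)) (cat_id b)
}.

Record subcategory (C : category) := Subcategory {
  sub_ob : C -> Prop;
  sub_hom : forall a b : C, cat_hom a b -> Prop;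
  sub_hom_ob : forall (a b : C) (f : cat_hom a b),
    sub_hom f -> sub_ob a /\ sub_ob b;
  sub_id : forall a, sub_ob a -> sub_hom (cat_id a);
  sub_comp : forall (a b c : C) (g : cat_hom b c) (f : cat_hom a b),
    sub_hom g -> sub_hom f -> sub_hom (g \oc f)
}.

Section FullSubcategory.
Variables (C : category) (P : C -> Prop).

Definition full_hom (a b : C) (f : cat_hom a b) : Prop := P a /\ P b.
Fact full_hom_ob (a b : C) (f : cat_hom a b) : full_hom f -> P a /\ P b.
Proof. by []. Qed.
Fact full_id a : P a -> full_hom (cat_id a).
Proof. by []. Qed.
Fact full_comp (a b c : C) (g : cat_hom b c) (f : cat_hom a b) :
  full_hom g -> full_hom f -> full_hom (g \oc f).
Proof. by case=> _ ? [? _]. Qed.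
Definition full_subcategory : subcategory C :=
  Subcategory full_hom_ob full_id full_comp.
End FullSubcategory.

Definition sub_iso (C : category) (S : subcategory C) (a b : C)
    (i : cat_iso a b) : Prop :=
  sub_hom S (iso_fwd i) /\ sub_hom S (iso_bwd i).

(* S is closed under the whole monoidal structure of C, so that S
   is monoidal with the restricted structure. *)
Record is_monoidal_subcategory (C : monoidal_category) (S : subcategory C) :
    Prop := IsMonoidalSubcategory {
  monsub_unit : sub_ob S (mon_unit C);
  monsub_ob : forall a b, sub_ob S a -> sub_ob S b -> sub_ob S (mon_ob a b);
  monsub_hom : forall (a a' b b' : C) (f : cat_hom a a') (g : cat_hom b b'),
    sub_hom S f -> sub_hom S g -> sub_hom S (mon_hom f g);
  monsub_assoc : forall a b c, sub_ob S a -> sub_ob S b -> sub_ob S c ->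
    sub_iso S (mon_assoc a b c);
  monsub_lunit : forall a, sub_ob S a -> sub_iso S (mon_lunit a);
  monsub_runit : forall a, sub_ob S a -> sub_iso S (mon_runit a)
}.

Section Presentation.
Variables (k : fieldType) (X : Type).

Inductive term : Type :=
| TVar of X
| TConst of k
| TAdd of term & term
| TOpp of term
| TMul of term & term.

(* The smallest congruence containing [rel] and the axioms of an associative
   unital k-algebra, the scalars being the central subring [TConst]. *)
Inductive pcong (rel : term -> term -> Prop) : term -> term -> Prop :=
| CRel s t of rel s t : pcong rel s t
| CRefl t : pcong rel t t
| CSym s t of pcong rel s t : pcong rel t s
| CTrans s t u of pcong rel s t & pcong rel t u : pcong rel s u
| CAdd s s' t t' of pcong rel s s' & pcong rel t t' :
    pcong rel (TAdd s t) (TAdd s' t')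
| COpp s s' of pcong rel s s' : pcong rel (TOpp s) (TOpp s')
| CMul s s' t t' of pcong rel s s' & pcong rel t t' :
    pcong rel (TMul s t) (TMul s' t')
| CAddA s t u : pcong rel (TAdd s (TAdd t u)) (TAdd (TAdd s t) u)
| CAddC s t : pcong rel (TAdd s t) (TAdd t s)
| CAdd0 t : pcong rel (TAdd (TConst 0) t) t
| CAddN t : pcong rel (TAdd (TOpp t) t) (TConst 0)
| CMulA s t u : pcong rel (TMul s (TMul t u)) (TMul (TMul s t) u)
| CMul1l t : pcong rel (TMul (TConst 1) t) t
| CMul1r t : pcong rel (TMul t (TConst 1)) t
| CMulDl s t u : pcong rel (TMul (TAdd s t) u) (TAdd (TMul s u) (TMul t u))
| CMulDr s t u : pcong rel (TMul s (TAdd t u)) (TAdd (TMul s t) (TMul s u))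
| CConstD a b : pcong rel (TConst (a + b)) (TAdd (TConst a) (TConst b))
| CConstM a b : pcong rel (TConst (a * b)) (TMul (TConst a) (TConst b))
| CConstC a t : pcong rel (TMul (TConst a) t) (TMul t (TConst a)).

HB.instance Definition _ := gen_eqMixin term.
HB.instance Definition _ := gen_choiceMixin term.

Section Quotient.
Variable rel : term -> term -> Prop.

Definition pcongb (s t : term) : bool := `[< pcong rel s t >].

Fact pcongb_refl : reflexive pcongb.
Proof. by move=> t; apply/asboolP; apply: CRefl. Qed.
Fact pcongb_sym : symmetric pcongb.
Proof. by move=> s t; apply/asboolP/asboolP => ?; apply: CSym. Qed.
Fact pcongb_trans : transitive pcongb.
Proof.
by move=> t s u /asboolP st /asboolP tu; apply/asboolP; apply: CTrans st tu.
Qed.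
Canonical pcongb_equiv := EquivRel pcongb pcongb_refl pcongb_sym pcongb_trans.

Definition presAlg := {eq_quot pcongb}.
HB.instance Definition _ := Choice.on presAlg.
HB.instance Definition _ := EqQuotient.on presAlg.

Lemma presP s t : reflect (pcong rel s t) (\pi_presAlg s == \pi_presAlg t).
Proof. by rewrite piE; apply: asboolP. Qed.

Lemma pres_eq s t : pcong rel s t -> \pi_presAlg s = \pi_presAlg t.
Proof. by move=> h; apply/eqP/presP. Qed.

Lemma pres_repr t : pcong rel (repr (\pi_presAlg t)) t.
Proof. by apply/presP; rewrite reprK. Qed.

Definition pconst (c : k) : presAlg := \pi_presAlg (TConst c).
Definition padd (a b : presAlg) : presAlg := \pi_presAlg (TAdd (repr a) (repr b)).
Definition popp (a : presAlg) : presAlg := \pi_presAlg (TOpp (repr a)).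
Definition pmul (a b : presAlg) : presAlg := \pi_presAlg (TMul (repr a) (repr b)).

Lemma pi_add s t : \pi_presAlg (TAdd s t) = padd (\pi s) (\pi t).
Proof. by apply: pres_eq; apply: CAdd; apply: CSym; apply: pres_repr. Qed.
Lemma pi_opp s : \pi_presAlg (TOpp s) = popp (\pi s).
Proof. by apply: pres_eq; apply: COpp; apply: CSym; apply: pres_repr. Qed.
Lemma pi_mul s t : \pi_presAlg (TMul s t) = pmul (\pi s) (\pi t).
Proof. by apply: pres_eq; apply: CMul; apply: CSym; apply: pres_repr. Qed.

Lemma pres_ind (P : presAlg -> Prop) : (forall t, P (\pi t)) -> forall a, P a.
Proof. by move=> h a; rewrite -[a]reprK. Qed.

Fact paddA : associative padd.
Proof.
elim/pres_ind=> s; elim/pres_ind=> t; elim/pres_ind=> u.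
by rewrite -!pi_add; apply/pres_eq/CAddA.
Qed.
Fact paddC : commutative padd.
Proof.
by elim/pres_ind=> s; elim/pres_ind=> t; rewrite -!pi_add; apply/pres_eq/CAddC.
Qed.
Fact padd0 : left_id (pconst 0) padd.
Proof. by elim/pres_ind=> s; rewrite -!pi_add; apply/pres_eq/CAdd0. Qed.
Fact paddN : left_inverse (pconst 0) popp padd.
Proof.
by elim/pres_ind=> s; rewrite -pi_opp -!pi_add; apply/pres_eq/CAddN.
Qed.
HB.instance Definition _ :=
  GRing.isZmodule.Build presAlg paddA paddC padd0 paddN.

Fact pmulA : associative pmul.
Proof.
elim/pres_ind=> s; elim/pres_ind=> t; elim/pres_ind=> u.
by rewrite -!pi_mul; apply/pres_eq/CMulA.
Qed.
Fact pmul1l : left_id (pconst 1) pmul.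
Proof. by elim/pres_ind=> s; rewrite -!pi_mul; apply/pres_eq/CMul1l. Qed.
Fact pmul1r : right_id (pconst 1) pmul.
Proof. by elim/pres_ind=> s; rewrite -!pi_mul; apply/pres_eq/CMul1r. Qed.
Fact pmulDl : left_distributive pmul padd.
Proof.
elim/pres_ind=> s; elim/pres_ind=> t; elim/pres_ind=> u.
by rewrite -!(pi_add, pi_mul); apply/pres_eq/CMulDl.
Qed.
Fact pmulDr : right_distributive pmul padd.
Proof.
elim/pres_ind=> s; elim/pres_ind=> t; elim/pres_ind=> u.
by rewrite -!(pi_add, pi_mul); apply/pres_eq/CMulDr.
Qed.
HB.instance Definition _ := GRing.Zmodule_isPzRing.Build presAlg
  pmulA pmul1l pmul1r pmulDl pmulDr.

Lemma pconstD a b : pconst (a + b) = pconst a + pconst b.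
Proof. by rewrite -[RHS]pi_add; apply/pres_eq/CConstD. Qed.
Lemma pconstM a b : pconst (a * b) = pconst a * pconst b.
Proof. by rewrite -[RHS]pi_mul; apply/pres_eq/CConstM. Qed.
Lemma pconstC a u : pconst a * u = u * pconst a.
Proof.
by elim/pres_ind: u => t; rewrite -[LHS]pi_mul -[RHS]pi_mul; apply/pres_eq/CConstC.
Qed.

Definition pscale (c : k) (u : presAlg) : presAlg := pconst c * u.

Fact pscaleA a b u : pscale a (pscale b u) = pscale (a * b) u.
Proof. by rewrite /pscale pconstM mulrA. Qed.
Fact pscale1 : left_id 1 pscale.
Proof. by move=> u; apply: mul1r. Qed.
Fact pscaleDr : right_distributive pscale +%R.
Proof. by move=> a u v; apply: mulrDr. Qed.
Fact pscaleDl u : {morph pscale^~ u : a b / a + b}.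
Proof. by move=> a b; rewrite /pscale pconstD mulrDl. Qed.
HB.instance Definition _ := GRing.Zmodule_isLmodule.Build k presAlg
  pscaleA pscale1 pscaleDr pscaleDl.

Lemma pscaleE (c : k) (u : presAlg) : c *: u = pconst c * u.
Proof. by []. Qed.
Lemma pscaleAl (a : k) (u v : presAlg) : a *: (u * v) = (a *: u) * v.
Proof. by rewrite !pscaleE mulrA. Qed.
Lemma pscaleAr (a : k) (u v : presAlg) : a *: (u * v) = u * (a *: v).
Proof. by rewrite !pscaleE !mulrA pconstC. Qed.

Definition pgen (x : X) : presAlg := \pi_presAlg (TVar x).

Lemma presAlg_gen_ind (P : presAlg -> Prop) :
  (forall x, P (pgen x)) -> (forall c : k, P (c *: (1 : presAlg))) ->
  (forall a b, P a -> P b -> P (a + b)) -> (forall a, P a -> P (- a)) ->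
  (forall a b, P a -> P b -> P (a * b)) -> forall a, P a.
Proof.
move=> hX h1 hD hN hM; elim/pres_ind; elim=> //.
- by move=> c; rewrite -[\pi_presAlg _]mulr1; apply: h1.
- by move=> s hs t ht; rewrite pi_add; apply: hD.
- by move=> s hs; rewrite pi_opp; apply: hN.
- by move=> s hs t ht; rewrite pi_mul; apply: hM.
Qed.

End Quotient.

(* [B] is a ring made into a k-algebra by the central morphism [eta]; this
   covers matrix rings of size 0, which are not [algType]. *)
Section Lift.
Variables (B : pzRingType) (eta : {rmorphism k -> B}).
Hypothesis etaC : forall c b, eta c * b = b * eta c.
Variable v : X -> B.

Fixpoint teval (t : term) : B :=
  match t with
  | TVar x => v x
  | TConst c => eta c
  | TAdd s t => teval s + teval t
  | TOpp s => - teval s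
  | TMul s t => teval s * teval t
  end.

Definition respects (rel : term -> term -> Prop) : Prop :=
  forall s t, rel s t -> teval s = teval t.

Variables (rel : term -> term -> Prop) (hrel : respects rel).

Lemma teval_cong s t : pcong rel s t -> teval s = teval t.
Proof.
elim=> //=; clear s t.
- by move=> s t u _ -> _ ->.
- by move=> s s' t t' _ -> _ ->.
- by move=> s s' _ ->.
- by move=> s s' t t' _ -> _ ->.
- by move=> *; rewrite addrA.
- by move=> *; rewrite addrC.
- by move=> *; rewrite rmorph0 add0r.
- by move=> *; rewrite rmorph0 addNr.
- by move=> *; rewrite mulrA.
- by move=> *; rewrite rmorph1 mul1r.
- by move=> *; rewrite rmorph1 mulr1.
- by move=> *; rewrite mulrDl.
- by move=> *; rewrite mulrDr.
- by move=> *; rewrite rmorphD.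
- by move=> *; rewrite rmorphM.
Qed.

(* The algebra map out of a presented algebra with prescribed values on the
   generators. *)
Definition pres_lift (a : presAlg rel) : B := teval (repr a).

Lemma pres_lift_pi t : pres_lift (\pi_(presAlg rel) t) = teval t.
Proof. exact/teval_cong/pres_repr. Qed.

Lemma pres_lift_gen x : pres_lift (pgen rel x) = v x.
Proof. exact: pres_lift_pi. Qed.

Lemma pres_lift_monoid : monoid_morphism pres_lift.
Proof.
split; first by rewrite -[1]/(\pi_(presAlg rel) (TConst 1)) pres_lift_pi /= rmorph1.
by elim/pres_ind=> s; elim/pres_ind=> t; rewrite -[_ * _]pi_mul !pres_lift_pi.
Qed.

Lemma pres_lift_linear c a b :
  pres_lift (c *: a + b) = eta c * pres_lift a + pres_lift b.
Proof.
rewrite pscaleE; elim/pres_ind: a => s; elim/pres_ind: b => t.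
by rewrite -[_ * _]pi_mul -[LHS]/(pres_lift (padd _ _)) -pi_add !pres_lift_pi.
Qed.

End Lift.
End Presentation.

Arguments TVar {k X}.
Arguments TConst {k X}.
Arguments pgen {k X rel}.

Declare Scope palg_scope.
Delimit Scope palg_scope with palg.
Notation "s + t" := (TAdd s t) : palg_scope.
Notation "- s" := (TOpp s) : palg_scope.
Notation "s * t" := (TMul s t) : palg_scope.
Notation "1" := (TConst 1%R) : palg_scope.

(* The tensor product over k of A and B, presented as the universal k-algebra
   receiving algebra maps from A and B with commuting images; a (x) b is the
   product of the images of a and b. *)
Section TensorAlgebra.
Variables (k : fieldType) (A B : algType k).

Local Notation iA a := (TVar (inl a)).
Local Notation iB b := (TVar (inr b)).

Inductive tens_rel : term k (A + B) -> term k (A + B) -> Prop :=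
| tens_rel_l1 c : tens_rel (iA c%:A) (TConst c)
| tens_rel_lD a b : tens_rel (iA (a + b)) (iA a + iA b)%palg
| tens_rel_lM a b : tens_rel (iA (a * b)) (iA a * iA b)%palg
| tens_rel_r1 c : tens_rel (iB c%:A) (TConst c)
| tens_rel_rD a b : tens_rel (iB (a + b)) (iB a + iB b)%palg
| tens_rel_rM a b : tens_rel (iB (a * b)) (iB a * iB b)%palg
| tens_rel_C a b : tens_rel (iA a * iB b)%palg (iB b * iA a)%palg.

Definition tensAlg := presAlg tens_rel.
HB.instance Definition _ := GRing.PzRing.on tensAlg.
HB.instance Definition _ := GRing.Lmodule.on tensAlg.

Definition tens_inl (a : A) : tensAlg := pgen (inl a).
Definition tens_inr (b : B) : tensAlg := pgen (inr b).
Definition tensor (a : A) (b : B) : tensAlg := tens_inl a * tens_inr b.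

Lemma tens_inlD a b : tens_inl (a + b) = tens_inl a + tens_inl b.
Proof. by rewrite -[RHS]pi_add; apply/pres_eq/CRel/tens_rel_lD. Qed.
Lemma tens_inlM a b : tens_inl (a * b) = tens_inl a * tens_inl b.
Proof. by rewrite -[RHS]pi_mul; apply/pres_eq/CRel/tens_rel_lM. Qed.
Lemma tens_inlA c : tens_inl c%:A = c *: (1 : tensAlg).
Proof. by rewrite pscaleE mulr1; apply/pres_eq/CRel/tens_rel_l1. Qed.
Lemma tens_inrD a b : tens_inr (a + b) = tens_inr a + tens_inr b.
Proof. by rewrite -[RHS]pi_add; apply/pres_eq/CRel/tens_rel_rD. Qed.
Lemma tens_inrM a b : tens_inr (a * b) = tens_inr a * tens_inr b.
Proof. by rewrite -[RHS]pi_mul; apply/pres_eq/CRel/tens_rel_rM. Qed.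
Lemma tens_inrA c : tens_inr c%:A = c *: (1 : tensAlg).
Proof. by rewrite pscaleE mulr1; apply/pres_eq/CRel/tens_rel_r1. Qed.
Lemma tens_inC a b : tens_inl a * tens_inr b = tens_inr b * tens_inl a.
Proof.
by rewrite -[LHS]pi_mul -[RHS]pi_mul; apply/pres_eq/CRel/tens_rel_C.
Qed.

Lemma tensorM a b a' b' : tensor a b * tensor a' b' = tensor (a * a') (b * b').
Proof.
rewrite /tensor tens_inlM tens_inrM !mulrA; congr (_ * _).
by rewrite -!mulrA tens_inC.
Qed.

Lemma tensor11 : tensor 1 1 = 1.
Proof.
by rewrite /tensor -[X in tens_inl X]scale1r -[X in tens_inr X]scale1r
  tens_inlA tens_inrA !scale1r mulr1.
Qed.

Lemma tensorDl a a' b : tensor (a + a') b = tensor a b + tensor a' b.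
Proof. by rewrite /tensor tens_inlD mulrDl. Qed.

Lemma tensorDr a b b' : tensor a (b + b') = tensor a b + tensor a b'.
Proof. by rewrite /tensor tens_inrD mulrDr. Qed.

Lemma tensorZl c a b : tensor (c *: a) b = c *: tensor a b.
Proof.
by rewrite /tensor -[a in LHS]mul1r scalerAl tens_inlM tens_inlA -pscaleAl
  mul1r -pscaleAl.
Qed.

Lemma tensorZr c a b : tensor a (c *: b) = c *: tensor a b.
Proof.
by rewrite /tensor -[b in LHS]mul1r scalerAl tens_inrM tens_inrA -pscaleAl
  mul1r -pscaleAr.
Qed.

Section Lift.
Variables (C : pzRingType) (eta : {rmorphism k -> C}).
Variables (f : {rmorphism A -> C}) (g : {rmorphism B -> C}).
Hypothesis etaC : forall c b, eta c * b = b * eta c.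
Hypothesis f_eta : forall c, f c%:A = eta c.
Hypothesis g_eta : forall c, g c%:A = eta c.
Hypothesis fgC : forall a b, f a * g b = g b * f a.

Definition tens_val (x : A + B) : C :=
  match x with inl a => f a | inr b => g b end.

Lemma tens_lift_respects : respects eta tens_val tens_rel.
Proof.
by move=> s t [] * /=; rewrite ?(f_eta, g_eta, fgC, rmorphD, rmorphM).
Qed.

Definition tens_lift : tensAlg -> C := pres_lift eta tens_val (rel := tens_rel).

Lemma tens_liftE a b : tens_lift (tensor a b) = f a * g b.
Proof.
rewrite [LHS](pres_lift_monoid etaC tens_lift_respects).2.
by rewrite !(pres_lift_gen etaC tens_lift_respects).
Qed.
Lemma tens_lift_linear c a b :
  tens_lift (c *: a + b) = eta c * tens_lift a + tens_lift b.
Proof. exact: (pres_lift_linear etaC tens_lift_respects). Qed.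
Lemma tens_lift_monoid : monoid_morphism tens_lift.
Proof. exact: (pres_lift_monoid etaC tens_lift_respects). Qed.
End Lift.
End TensorAlgebra.

Notation "a '(x)' b" := (tensor a b) (at level 40, no associativity) : ring_scope.

Section HopfL.
Variable k : fieldType.

Inductive Lgen := Gen_y | Gen_g | Gen_gV.

Local Notation y := (TVar Gen_y).
Local Notation g := (TVar Gen_g).
Local Notation gV := (TVar Gen_gV).

Inductive Lrel : term k Lgen -> term k Lgen -> Prop :=
| Lrel_gV : Lrel (g * gV)%palg 1%palg
| Lrel_Vg : Lrel (gV * g)%palg 1%palg
| Lrel_gy : Lrel (g * y * gV)%palg (- y)%palg.

Definition L := presAlg Lrel.
HB.instance Definition _ := GRing.PzRing.on L.
HB.instance Definition _ := GRing.Lmodule.on L.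

Definition Ly : L := pgen Gen_y.
Definition Lg : L := pgen Gen_g.
Definition LgV : L := pgen Gen_gV.

Lemma LgK : Lg * LgV = 1.
Proof. by rewrite -[LHS]pi_mul; apply/pres_eq/CRel/Lrel_gV. Qed.
Lemma LgVK : LgV * Lg = 1.
Proof. by rewrite -[LHS]pi_mul; apply/pres_eq/CRel/Lrel_Vg. Qed.
Lemma Lgy : Lg * Ly * LgV = - Ly.
Proof.
rewrite -[RHS]pi_opp -[Lg * Ly]pi_mul -[LHS]pi_mul.
exact/pres_eq/CRel/Lrel_gy.
Qed.

Lemma L_gen_ind (P : L -> Prop) :
  P Ly -> P Lg -> P LgV -> (forall c : k, P (c *: (1 : L))) ->
  (forall a b, P a -> P b -> P (a + b)) -> (forall a, P a -> P (- a)) ->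
  (forall a b, P a -> P b -> P (a * b)) -> forall a, P a.
Proof. by move=> hy hg hgV *; apply: presAlg_gen_ind => //; case. Qed.

Section Lift.
Variables (B : pzRingType) (eta : {rmorphism k -> B}).
Hypothesis etaC : forall c b, eta c * b = b * eta c.
Variables (vy vg vgV : B).
Hypothesis hgV : vg * vgV = 1.
Hypothesis hVg : vgV * vg = 1.
Hypothesis hgy : vg * vy * vgV = - vy.

Definition Lval (x : Lgen) : B :=
  match x with Gen_y => vy | Gen_g => vg | Gen_gV => vgV end.

Lemma Llift_respects : respects eta Lval Lrel.
Proof. by move=> s t [] /=; rewrite ?rmorph1. Qed.

Definition Llift : L -> B := pres_lift eta Lval (rel := Lrel).

Lemma Llift_y : Llift Ly = vy.
Proof. exact: (pres_lift_gen etaC Llift_respects). Qed.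
Lemma Llift_g : Llift Lg = vg.
Proof. exact: (pres_lift_gen etaC Llift_respects). Qed.
Lemma Llift_gV : Llift LgV = vgV.
Proof. exact: (pres_lift_gen etaC Llift_respects). Qed.
Lemma Llift_monoid : monoid_morphism Llift.
Proof. exact: (pres_lift_monoid etaC Llift_respects). Qed.
Lemma Llift_linear c a b : Llift (c *: a + b) = eta c * Llift a + Llift b.
Proof. exact: (pres_lift_linear etaC Llift_respects). Qed.
End Lift.

(* The only algebra map that can be a counit for [Delta] below. *)
Definition counit : L -> k^o := Llift (idfun : {rmorphism k -> k}) 0 1 1.

Fact counit_gy : 1 * 0 * 1 = - 0 :> k.
Proof. by rewrite mulr0 mul0r oppr0. Qed.
Fact counit_monoid : monoid_morphism counit.
Proof.
exact: (@Llift_monoid k idfun (@mulrC k) 0 1 1 (mulr1 1) (mulr1 1) counit_gy).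
Qed.
Fact counit_linear : linear counit.
Proof.
exact: (@Llift_linear k idfun (@mulrC k) 0 1 1 (mulr1 1) (mulr1 1) counit_gy).
Qed.
HB.instance Definition _ := GRing.isLinear.Build k L k^o *:%R counit counit_linear.
HB.instance Definition _ := GRing.isMonoidMorphism.Build L k^o counit counit_monoid.

Fact L_nonzero : (1 : L) != 0.
Proof.
apply/eqP=> /(congr1 counit); rewrite rmorph1 linear0.
by move/eqP; rewrite oner_eq0.
Qed.
HB.instance Definition _ := GRing.PzSemiRing_isNonZero.Build L L_nonzero.
HB.instance Definition _ := GRing.Lmodule_isLalgebra.Build k L (@pscaleAl k _ Lrel).
HB.instance Definition _ := GRing.Lalgebra_isAlgebra.Build k L (@pscaleAr k _ Lrel).

Definition LL := tensAlg L L.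
HB.instance Definition _ := GRing.PzRing.on LL.
HB.instance Definition _ := GRing.Lmodule.on LL.

Fact LL_nonzero : (1 : LL) != 0.
Proof.
have cC c (b : k) : idfun c * b = b * idfun c by rewrite mulrC.
have cA (c : k) : (counit : L -> k) c%:A = idfun c.
  by rewrite linearZ /= rmorph1; apply: mulr1.
have fg (a b : L) : (counit a : k) * counit b = counit b * counit a
  by rewrite mulrC.
pose lft := @tens_lift k L L k idfun counit counit.
have lft0 : lft 0 = 0.
  have := tens_lift_linear cC cA cA fg 1 0 0; rewrite scaler0 addr0 -/lft mul1r.
  by move/(congr1 (fun x => x - lft 0)); rewrite subrr addrK.
apply/eqP=> h; have := (tens_lift_monoid cC cA cA fg).1.
by rewrite h -/lft lft0 => /eqP; rewrite eq_sym oner_eq0.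
Qed.
HB.instance Definition _ := GRing.PzSemiRing_isNonZero.Build LL LL_nonzero.
HB.instance Definition _ :=
  GRing.Lmodule_isLalgebra.Build k LL (@pscaleAl k _ (@tens_rel k L L)).
HB.instance Definition _ :=
  GRing.Lalgebra_isAlgebra.Build k LL (@pscaleAr k _ (@tens_rel k L L)).

Fact Delta_gV : (Lg (x) Lg : LL) * (LgV (x) LgV) = 1.
Proof. by rewrite [LHS]tensorM LgK tensor11. Qed.
Fact Delta_Vg : (LgV (x) LgV : LL) * (Lg (x) Lg) = 1.
Proof. by rewrite [LHS]tensorM LgVK tensor11. Qed.
Fact Delta_gy : (Lg (x) Lg : LL) * (Ly (x) 1 + Lg (x) Ly) * (LgV (x) LgV)
  = - (Ly (x) 1 + Lg (x) Ly).
Proof.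
rewrite mulrDr mulrDl.
rewrite !(@tensorM k L L : forall a b a' b', (a (x) b : LL) * (a' (x) b') = _).
rewrite mulr1 LgK Lgy -mulrA LgK mulr1.
rewrite -[- Ly]scaleN1r tensorZl tensorZr.
by rewrite -scalerDr scaleN1r.
Qed.

Fact in_algC (A : algType k) (c : k) (u : A) : in_alg A c * u = u * in_alg A c.
Proof. by rewrite /= mulr_algl mulr_algr. Qed.

Definition Delta : L -> LL :=
  Llift (in_alg LL) (Ly (x) 1 + Lg (x) Ly) (Lg (x) Lg) (LgV (x) LgV).

Fact Delta_linear : linear Delta.
Proof.
move=> c u v.
by rewrite [LHS](Llift_linear (in_algC (A := LL)) Delta_gV Delta_Vg Delta_gy)
  /= mulr_algl.
Qed.
Fact Delta_monoid : monoid_morphism Delta.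
Proof. exact: (Llift_monoid (in_algC (A := LL)) Delta_gV Delta_Vg Delta_gy). Qed.
HB.instance Definition _ :=
  GRing.isLinear.Build k L LL *:%R Delta Delta_linear.
HB.instance Definition _ := GRing.isMonoidMorphism.Build L LL Delta Delta_monoid.

Lemma Delta_y : Delta Ly = Ly (x) 1 + Lg (x) Ly.
Proof. exact: (Llift_y (in_algC (A := LL)) Delta_gV Delta_Vg Delta_gy). Qed.
Lemma Delta_g : Delta Lg = Lg (x) Lg.
Proof. exact: (Llift_g (in_algC (A := LL)) Delta_gV Delta_Vg Delta_gy). Qed.
Lemma Delta_gVE : Delta LgV = LgV (x) LgV.
Proof. exact: (Llift_gV (in_algC (A := LL)) Delta_gV Delta_Vg Delta_gy). Qed.

Lemma counit_y : counit Ly = 0.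
Proof. exact: (Llift_y (eta := idfun) (@mulrC k) (mulr1 1) (mulr1 1) counit_gy). Qed.
Lemma counit_g : counit Lg = 1.
Proof. exact: (Llift_g (eta := idfun) (@mulrC k) (mulr1 1) (mulr1 1) counit_gy). Qed.

(* Finite-dimensional left modules in coordinates: [x : L] acts on column vectors
   of size [dim] by left multiplication with [act x]. *)
Record Lmod := LMod {
  dim : nat;
  act :> L -> 'M[k]_dim;
  act_linear : linear act;
  act_monoid : monoid_morphism act
}.
HB.instance Definition _ (M : Lmod) :=
  GRing.isLinear.Build k L 'M[k]_(dim M) *:%R (act M) (act_linear M).
HB.instance Definition _ (M : Lmod) :=
  GRing.isMonoidMorphism.Build L 'M[k]_(dim M) (act M) (act_monoid M).

Section ModuleFromMatrices.
Variables (n : nat) (G Y : 'M[k]_n).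
Hypotheses (uG : G \in unitmx) (GY : G *m Y = - (Y *m G)).

Fact scalar_mx_central (c : k) (A : 'M[k]_n) : c%:M * A = A * c%:M.
Proof. by rewrite -!mulmxE mul_scalar_mx mul_mx_scalar. Qed.

Fact modmx_gy : G * Y * invmx G = - Y.
Proof. by rewrite -!mulmxE GY mulNmx mulmxK. Qed.

Definition modmx_fun : L -> 'M[k]_n :=
  Llift (scalar_mx : {rmorphism k -> 'M[k]_n}) Y G (invmx G).

Fact modmx_linear : linear modmx_fun.
Proof.
move=> c u v; rewrite [LHS](Llift_linear scalar_mx_central (mulmxV uG)
  (mulVmx uG) modmx_gy) /=.
by congr (_ + _); apply: mul_scalar_mx.
Qed.
Fact modmx_monoid : monoid_morphism modmx_fun.
Proof.
exact: (Llift_monoid scalar_mx_central (mulmxV uG) (mulVmx uG) modmx_gy).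
Qed.

Definition modmx : Lmod := LMod modmx_linear modmx_monoid.

Lemma modmx_g : modmx Lg = G.
Proof. exact: (Llift_g scalar_mx_central (mulmxV uG) (mulVmx uG) modmx_gy). Qed.
Lemma modmx_y : modmx Ly = Y.
Proof. exact: (Llift_y scalar_mx_central (mulmxV uG) (mulVmx uG) modmx_gy). Qed.
End ModuleFromMatrices.

Definition mx2 (a b c d : k) : 'M[k]_2 :=
  \matrix_(i < 2, j < 2) nth 0 (nth [::] [:: [:: a; b]; [:: c; d]] i) j.

Section Families.
Variables (a b : k) (a0 : a != 0).

Fact Kmod_unit : (a%:M : 'M[k]_1) \in unitmx.
Proof. by rewrite unitmxE det_scalar expr1 unitfE. Qed.
Fact Kmod_rel : a%:M *m 0 = - (0 *m a%:M) :> 'M[k]_1.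
Proof. by rewrite mulmx0 mul0mx oppr0. Qed.
Definition Kmod : Lmod := modmx Kmod_unit Kmod_rel.

Fact UWmod_unit : mx2 a 0 0 (- a) \in unitmx.
Proof.
rewrite unitmxE det_trig; last first.
  by apply/is_trig_mxP=> -[[|[|//]] ?] [[|[|//]] ?] //=; rewrite mxE.
by rewrite !big_ord_recr big_ord0 !mxE /= mul1r mulrN unitrN unitfE mulf_neq0.
Qed.

Fact Umod_rel :
  mx2 a 0 0 (- a) *m mx2 0 b 1 0 = - (mx2 0 b 1 0 *m mx2 a 0 0 (- a)).
Proof.
apply/matrixP=> i j; rewrite !mxE !big_ord_recr !big_ord0 !mxE /=.
case: i => [[|[|//]] ?]; case: j => [[|[|//]] ?] /=;
by rewrite ?(mulr0, mul0r, mulr1, mul1r, addr0, add0r, oppr0, mulrN, opprK) //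
  mulrC.
Qed.
Definition Umod : Lmod := modmx UWmod_unit Umod_rel.

Fact Wmod_rel :
  mx2 a 0 0 (- a) *m mx2 0 1 0 0 = - (mx2 0 1 0 0 *m mx2 a 0 0 (- a)).
Proof.
apply/matrixP=> i j; rewrite !mxE !big_ord_recr !big_ord0 !mxE /=.
case: i => [[|[|//]] ?]; case: j => [[|[|//]] ?] /=;
by rewrite ?(mulr0, mul0r, mulr1, mul1r, addr0, add0r, oppr0, mulrN, opprK).
Qed.
Definition Wmod : Lmod := modmx UWmod_unit Wmod_rel.
End Families.

Definition is_Lhom (M N : Lmod) (F : 'M[k]_(dim N, dim M)) : Prop :=
  forall x : L, F *m M x = N x *m F.

Lemma is_Lhom_gen (M N : Lmod) (F : 'M[k]_(dim N, dim M)) :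
  F *m M Ly = N Ly *m F -> F *m M Lg = N Lg *m F -> is_Lhom F.
Proof.
move=> hy hg.
have hgV : F *m M LgV = N LgV *m F.
  rewrite -[F *m M LgV]mul1mx.
  have -> : 1%:M = N LgV *m N Lg by rewrite mulmxE -rmorphM LgVK rmorph1.
  rewrite -mulmxA (mulmxA (N Lg)) -hg -(mulmxA F).
  by rewrite mulmxE -rmorphM LgK rmorph1 mulmx1.
apply: L_gen_ind => //.
- move=> c; rewrite !linearZ /= !rmorph1 -scalemxAl; congr (_ *: _).
  exact: etrans (mulmx1 _) (esym (mul1mx _)).
- by move=> u v hu hv; rewrite !linearD /= mulmxDl hu hv.
- by move=> u hu; rewrite !linearN /= mulNmx hu.
- move=> u v hu hv; rewrite !rmorphM -!mulmxE mulmxA hu -mulmxA hv.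
  by rewrite mulmxA.
Qed.

Section DirectSum.
Variables M N : Lmod.

Definition dsum_fun (x : L) : 'M[k]_(dim M + dim N) :=
  block_mx (M x) 0 0 (N x).

Fact dsum_linear : linear dsum_fun.
Proof.
move=> a u v.
by rewrite /dsum_fun !linearP scale_block_mx add_block_mx !scaler0 !addr0.
Qed.
Fact dsum_monoid : monoid_morphism dsum_fun.
Proof.
split=> [|u v]; rewrite /dsum_fun.
  by rewrite !rmorph1 -scalar_mx_block.
rewrite !rmorphM -!mulmxE mulmx_block.
by rewrite !mulmx0 !mul0mx !addr0 !add0r.
Qed.
Definition dsum : Lmod := LMod dsum_linear dsum_monoid.
End DirectSum.

Fact zeromod_linear : linear (fun _ : L => 0 : 'M[k]_0).
Proof. by move=> a u v; rewrite scaler0 addr0. Qed.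
Fact zeromod_monoid : monoid_morphism (fun _ : L => 0 : 'M[k]_0).
Proof. by split=> [|u v]; apply/matrixP=> -[]. Qed.
Definition zeromod : Lmod := LMod zeromod_linear zeromod_monoid.

Definition bigdsum (s : seq Lmod) : Lmod := foldr dsum zeromod s.

Section TensorModule.
Variables M N : Lmod.
Local Notation m := (dim M).
Local Notation n := (dim N).

Definition actl (x : L) : 'M[k]_(m * n) := M x *t 1%:M.
Definition actr (x : L) : 'M[k]_(m * n) := 1%:M *t N x.

Fact actl_linear : linear actl.
Proof.
move=> a u v; rewrite /actl linearP.
by apply/matrixP=> i j; rewrite !mxE mulrDl mulrA.
Qed.
Fact actr_linear : linear actr.
Proof.
move=> a u v; rewrite /actr linearP.
by apply/matrixP=> i j; rewrite !mxE mulrDr mulrCA.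
Qed.
Lemma tensmx11 (p q : nat) : (1%:M : 'M[k]_p) *t (1%:M : 'M[k]_q) = 1%:M.
Proof.
apply/matrixP=> i j.
case: (mxtens_indexP i) => i1 i2; case: (mxtens_indexP j) => j1 j2.
rewrite tensmxE !mxE -natrM mulnb; congr (nat_of_bool _)%:R.
by rewrite (can_eq (@mxtens_indexK _ _)) xpair_eqE.
Qed.
Fact actl_monoid : monoid_morphism actl.
Proof.
split=> [|u v]; rewrite /actl; first by rewrite [M _]rmorph1; exact: (tensmx11 m n).
by rewrite rmorphM -!mulmxE tensmx_mul mulmx1.
Qed.
Fact actr_monoid : monoid_morphism actr.
Proof.
split=> [|u v]; rewrite /actr; first by rewrite [N _]rmorph1; exact: (tensmx11 m n).
by rewrite rmorphM -!mulmxE tensmx_mul mulmx1.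
Qed.
HB.instance Definition _ :=
  GRing.isLinear.Build k L 'M[k]_(m * n) *:%R actl actl_linear.
HB.instance Definition _ :=
  GRing.isMonoidMorphism.Build L 'M[k]_(m * n) actl actl_monoid.
HB.instance Definition _ :=
  GRing.isLinear.Build k L 'M[k]_(m * n) *:%R actr actr_linear.
HB.instance Definition _ :=
  GRing.isMonoidMorphism.Build L 'M[k]_(m * n) actr actr_monoid.

Fact actl_scalar c : actl c%:A = c%:M.
Proof. by rewrite linearZ rmorph1 /= -[RHS]scalemx1. Qed.
Fact actr_scalar c : actr c%:A = c%:M.
Proof. by rewrite linearZ rmorph1 /= -[RHS]scalemx1. Qed.
Fact actlrC a b : actl a * actr b = actr b * actl a.
Proof. by rewrite -!mulmxE !tensmx_mul !mulmx1 !mul1mx. Qed.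

(* The action of [LL] on the tensor product: a (x) b acts by M a *t N b. *)
Definition actLL : LL -> 'M[k]_(m * n) :=
  tens_lift (scalar_mx : {rmorphism k -> 'M[k]_(m * n)}) actl actr.

Local Notation C := (@scalar_mx_central (m * n)).
Lemma actLLE a b : actLL (a (x) b) = M a *t N b.
Proof.
rewrite /actLL (tens_liftE C actl_scalar actr_scalar actlrC).
by rewrite -mulmxE tensmx_mul mulmx1 mul1mx.
Qed.
Fact actLL_linear : linear actLL.
Proof.
move=> c u v.
rewrite [LHS](tens_lift_linear C actl_scalar actr_scalar actlrC) /=.
by congr (_ + _); apply: mul_scalar_mx.
Qed.
Fact actLL_monoid : monoid_morphism actLL.
Proof. exact: (tens_lift_monoid C actl_scalar actr_scalar actlrC). Qed.
HB.instance Definition _ :=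
  GRing.isLinear.Build k LL 'M[k]_(m * n) *:%R actLL actLL_linear.
HB.instance Definition _ :=
  GRing.isMonoidMorphism.Build LL 'M[k]_(m * n) actLL actLL_monoid.

Definition tensmod_fun (x : L) : 'M[k]_(m * n) := actLL (Delta x).

Fact tensmod_linear : linear tensmod_fun.
Proof. by move=> c u v; rewrite /tensmod_fun !linearP. Qed.
Fact tensmod_monoid : monoid_morphism tensmod_fun.
Proof.
by split=> [|u v]; rewrite /tensmod_fun ?rmorphM //; rewrite !rmorph1.
Qed.
Definition tensmod : Lmod := LMod tensmod_linear tensmod_monoid.

Lemma tensmod_g : tensmod Lg = M Lg *t N Lg.
Proof. by rewrite /= /tensmod_fun Delta_g actLLE. Qed.
Lemma tensmod_y : tensmod Ly = M Ly *t 1%:M + M Lg *t N Ly.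
Proof. by rewrite /= /tensmod_fun Delta_y linearD /= !actLLE rmorph1. Qed.
End TensorModule.

Definition unitmod_fun (x : L) : 'M[k]_1 := (counit x)%:M.
Fact unitmod_linear : linear unitmod_fun.
Proof.
move=> a u v; rewrite /unitmod_fun linearP /= raddfD /=.
by rewrite -scale_scalar_mx.
Qed.
Fact unitmod_monoid : monoid_morphism unitmod_fun.
Proof.
split=> [|u v]; rewrite /unitmod_fun; first by rewrite rmorph1.
by rewrite rmorphM /= scalar_mxM.
Qed.
Definition unitmod : Lmod := LMod unitmod_linear unitmod_monoid.

End HopfL.

Arguments Ly {k}.
Arguments Lg {k}.
Arguments LgV {k}.

Section Rep.
Variable k : fieldType.
Local Notation Lmod := (Lmod k).

Lemma tensmxDl m n p q (A A' : 'M[k]_(m, n)) (B : 'M[k]_(p, q)) :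
  (A + A') *t B = A *t B + A' *t B.
Proof. by apply/matrixP=> i j; rewrite !mxE mulrDl. Qed.
Lemma tensmxDr m n p q (A : 'M[k]_(m, n)) (B B' : 'M[k]_(p, q)) :
  A *t (B + B') = A *t B + A *t B'.
Proof. by apply/matrixP=> i j; rewrite !mxE mulrDr. Qed.

(* The identity matrix, between equal dimensions. *)
Definition idmx (p q : nat) (e : p = q) : 'M[k]_(q, p) :=
  castmx (e, erefl p) 1%:M.

Lemma idmx1 p (e : p = p) : idmx e = 1%:M.
Proof. by rewrite /idmx (eq_irrelevance e erefl) castmx_id. Qed.
Lemma idmxM p q r (e : p = q) (e' : q = r) : idmx e' *m idmx e = idmx (etrans e e').
Proof. by case: r / e'; case: q / e; rewrite !idmx1 mulmx1. Qed.
Lemma idmx_tensl p q r (e : p = q) (e' : (p * r = q * r)%N) :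
  idmx e *t (1%:M : 'M_r) = idmx e'.
Proof. by case: q / e e' => e'; rewrite !idmx1 tensmx11. Qed.
Lemma idmx_tensr p q r (e : p = q) (e' : (r * p = r * q)%N) :
  (1%:M : 'M_r) *t idmx e = idmx e'.
Proof. by case: q / e e' => e'; rewrite !idmx1 tensmx11. Qed.
Lemma mul_idmx p q r (e : p = q) (A : 'M_(p, r)) :
  idmx e *m A = castmx (e, erefl r) A.
Proof. by case: q / e; rewrite idmx1 mul1mx castmx_id. Qed.
Lemma mulmx_idmx p q r (e : p = q) (A : 'M_(r, q)) :
  A *m idmx e = castmx (erefl r, esym e) A.
Proof. by case: q / e A => A; rewrite idmx1 mulmx1 castmx_id. Qed.

Lemma idmx_intertwine p q p' q' (e : p = q) (e' : p' = q')
    (A : 'M_(p', p)) (B : 'M_(q', q)) :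
  castmx (e', e) A = B -> idmx e' *m A = B *m idmx e.
Proof.
case: q / e B => B; case: q' / e' B => B.
by rewrite castmx_id => ->; rewrite !idmx1 mul1mx mulmx1.
Qed.

Definition idmx_assoc m n p : (m * n * p = m * (n * p))%N := esym (mulnA m n p).

Lemma tensmxA m n m' n' m'' n''
    (A : 'M[k]_(m, n)) (B : 'M[k]_(m', n')) (C : 'M[k]_(m'', n'')) :
  castmx (idmx_assoc m m' m'', idmx_assoc n n' n'') (A *t B *t C)
  = A *t (B *t C).
Proof.
have ix a b c (i : 'I_a) (j : 'I_b) (l : 'I_c) :
    cast_ord (esym (idmx_assoc a b c)) (mxtens_index (i, mxtens_index (j, l)))
    = mxtens_index (mxtens_index (i, j), l).
  by apply: val_inj; rewrite /= mulnDl mulnA addnA.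
apply/matrixP=> i j.
case: (mxtens_indexP i) => i1 i'; case: (mxtens_indexP i') => i2 i3.
case: (mxtens_indexP j) => j1 j'; case: (mxtens_indexP j') => j2 j3.
by rewrite castmxE !ix !tensmxE mulrA.
Qed.

Lemma tens1mx m n (A : 'M[k]_(m, n)) :
  castmx (mul1n m, mul1n n) ((1%:M : 'M_1) *t A) = A.
Proof.
rewrite [(1%:M : 'M_1) *t A]tens_scalar1mx castmx_comp.
by rewrite castmx_id.
Qed.
Lemma tensmx1 m n (A : 'M[k]_(m, n)) :
  castmx (muln1 m, muln1 n) (A *t (1%:M : 'M_1)) = A.
Proof. by rewrite tens_mx_scalar castmx_comp castmx_id scale1r. Qed.

Record Lhom (M N : Lmod) := LHom {
  Lhom_mx :> 'M[k]_(dim N, dim M);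
  LhomP : is_Lhom Lhom_mx
}.

Lemma Lhom_eq (M N : Lmod) (F G : Lhom M N) : Lhom_mx F = Lhom_mx G -> F = G.
Proof.
case: F G => [F hF] [G hG] /= e; case: G / e hG => hG.
by rewrite (Prop_irrelevance hF hG).
Qed.

Fact Lid_proof (M : Lmod) : is_Lhom (M := M) (N := M) 1%:M.
Proof. by move=> x; rewrite mul1mx mulmx1. Qed.
Definition Lid M := LHom (@Lid_proof M).

Fact Lcomp_proof (M N P : Lmod) (G : Lhom N P) (F : Lhom M N) :
  is_Lhom (M := M) (N := P) (G *m F).
Proof. by move=> x; rewrite -mulmxA LhomP mulmxA LhomP mulmxA. Qed.
Definition Lcomp M N P G F := LHom (@Lcomp_proof M N P G F).

Fact LcompA M N P Q (H : Lhom P Q) (G : Lhom N P) (F : Lhom M N) :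
  Lcomp H (Lcomp G F) = Lcomp (Lcomp H G) F.
Proof. by apply: Lhom_eq; rewrite /= mulmxA. Qed.
Fact Lcomp1l M N (F : Lhom M N) : Lcomp (Lid N) F = F.
Proof. by apply: Lhom_eq; rewrite /= mul1mx. Qed.
Fact Lcomp1r M N (F : Lhom M N) : Lcomp F (Lid M) = F.
Proof. by apply: Lhom_eq; rewrite /= mulmx1. Qed.

Definition repL_cat : category := Category LcompA Lcomp1l Lcomp1r.

Fact Ltens_proof (M M' N N' : Lmod) (F : Lhom M M') (G : Lhom N N') :
  is_Lhom (M := tensmod M N) (N := tensmod M' N') (F *t G).
Proof.
apply: is_Lhom_gen.
  rewrite !tensmod_y mulmxDr mulmxDl !tensmx_mul !LhomP.
  by rewrite mulmx1 mul1mx.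
by rewrite !tensmod_g !tensmx_mul !LhomP.
Qed.
Definition Ltens M M' N N' F G := LHom (@Ltens_proof M M' N N' F G).

Lemma idmx_iso (M N : Lmod) (e : dim M = dim N) :
  castmx (e, e) (M Ly) = N Ly -> castmx (e, e) (M Lg) = N Lg ->
  is_Lhom (M := M) (N := N) (idmx e) /\
  is_Lhom (M := N) (N := M) (idmx (esym e)).
Proof.
move=> hy hg; have hF : is_Lhom (M := M) (N := N) (idmx e).
  by apply: is_Lhom_gen; apply: idmx_intertwine.
split=> // x.
have hK : idmx (esym e) *m idmx e = 1%:M by rewrite idmxM idmx1.
have hK' : idmx e *m idmx (esym e) = 1%:M by rewrite idmxM idmx1.
by rewrite -[RHS]mul1mx -hK -!mulmxA (mulmxA (idmx e)) hF -!mulmxA hK' mulmx1.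
Qed.

Section IdIso.
Variables (M N : Lmod) (e : dim M = dim N).
Hypotheses (hy : castmx (e, e) (M Ly) = N Ly).
Hypotheses (hg : castmx (e, e) (M Lg) = N Lg).

Definition idiso_fwd : cat_hom (M : repL_cat) N := LHom (proj1 (idmx_iso hy hg)).
Definition idiso_bwd : cat_hom (N : repL_cat) M := LHom (proj2 (idmx_iso hy hg)).
Fact idiso_bwdK : idiso_bwd \oc idiso_fwd = cat_id (M : repL_cat).
Proof. by apply: Lhom_eq; rewrite /= idmxM idmx1. Qed.
Fact idiso_fwdK : idiso_fwd \oc idiso_bwd = cat_id (N : repL_cat).
Proof. by apply: Lhom_eq; rewrite /= idmxM idmx1. Qed.
Definition idiso : cat_iso (M : repL_cat) N := CatIso idiso_bwdK idiso_fwdK.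
End IdIso.

Section Constraints.
Variables M N P : Lmod.

Lemma castmxD m n m' n' (e : (m = m') * (n = n')) (A B : 'M[k]_(m, n)) :
  castmx e (A + B) = castmx e A + castmx e B.
Proof. by case: e => e e'; case: m' / e; case: n' / e'; rewrite !castmx_id. Qed.

Fact assoc_y : castmx (idmx_assoc (dim M) (dim N) (dim P),
    idmx_assoc (dim M) (dim N) (dim P)) (tensmod (tensmod M N) P Ly)
  = tensmod M (tensmod N P) Ly.
Proof.
rewrite !tensmod_y !tensmod_g tensmxDl tensmxDr !castmxD !tensmxA tensmx11.
by rewrite addrA.
Qed.
Fact assoc_g : castmx (idmx_assoc (dim M) (dim N) (dim P),
    idmx_assoc (dim M) (dim N) (dim P)) (tensmod (tensmod M N) P Lg)
  = tensmod M (tensmod N P) Lg.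
Proof. by rewrite !tensmod_g tensmxA. Qed.
Definition Lassoc := idiso (M := tensmod (tensmod M N) P)
  (N := tensmod M (tensmod N P)) assoc_y assoc_g.

Lemma unitmod_g : unitmod k Lg = 1%:M.
Proof. by rewrite /= /unitmod_fun counit_g. Qed.
Lemma unitmod_y : unitmod k Ly = 0.
Proof. by rewrite /= /unitmod_fun counit_y raddf0. Qed.

Fact lunit_y :
  castmx (mul1n (dim M), mul1n (dim M)) (tensmod (unitmod k) M Ly) = M Ly.
Proof. by rewrite tensmod_y unitmod_y unitmod_g tens0mx add0r tens1mx. Qed.
Fact lunit_g :
  castmx (mul1n (dim M), mul1n (dim M)) (tensmod (unitmod k) M Lg) = M Lg.
Proof. by rewrite tensmod_g unitmod_g tens1mx. Qed.
Definition Llunit := idiso (M := tensmod (unitmod k) M) lunit_y lunit_g.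

Fact runit_y :
  castmx (muln1 (dim M), muln1 (dim M)) (tensmod M (unitmod k) Ly) = M Ly.
Proof. by rewrite tensmod_y unitmod_y tensmx0 addr0 tensmx1. Qed.
Fact runit_g :
  castmx (muln1 (dim M), muln1 (dim M)) (tensmod M (unitmod k) Lg) = M Lg.
Proof. by rewrite tensmod_g unitmod_g tensmx1. Qed.
Definition Lrunit := idiso (M := tensmod M (unitmod k)) runit_y runit_g.
End Constraints.

Fact Ltens_id (M N : Lmod) : Ltens (Lid M) (Lid N) = Lid (tensmod M N).
Proof. by apply: Lhom_eq; rewrite /= tensmx11. Qed.
Fact Ltens_comp (M M' M'' N N' N'' : Lmod) (F' : Lhom M' M'') (F : Lhom M M')
    (G' : Lhom N' N'') (G : Lhom N N') :
  Ltens (Lcomp F' F) (Lcomp G' G) = Lcomp (Ltens F' G') (Ltens F G).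
Proof. by apply: Lhom_eq; rewrite /= tensmx_mul. Qed.
Fact Lassoc_nat (M M' N N' P P' : Lmod) (F : Lhom M M') (G : Lhom N N')
    (H : Lhom P P') :
  Lcomp (Ltens F (Ltens G H)) (iso_fwd (Lassoc M N P))
  = Lcomp (iso_fwd (Lassoc M' N' P')) (Ltens (Ltens F G) H).
Proof. by apply/Lhom_eq/esym/idmx_intertwine/tensmxA. Qed.
Fact Llunit_nat (M M' : Lmod) (F : Lhom M M') :
  Lcomp F (iso_fwd (Llunit M))
  = Lcomp (iso_fwd (Llunit M')) (Ltens (Lid (unitmod k)) F).
Proof. by apply/Lhom_eq/esym/idmx_intertwine/tens1mx. Qed.
Fact Lrunit_nat (M M' : Lmod) (F : Lhom M M') :
  Lcomp F (iso_fwd (Lrunit M))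
  = Lcomp (iso_fwd (Lrunit M')) (Ltens F (Lid (unitmod k))).
Proof. by apply/Lhom_eq/esym/idmx_intertwine/tensmx1. Qed.
Fact Lpentagon (M N P Q : Lmod) :
  Lcomp (iso_fwd (Lassoc M N (tensmod P Q))) (iso_fwd (Lassoc (tensmod M N) P Q))
  = Lcomp (Lcomp (Ltens (Lid M) (iso_fwd (Lassoc N P Q)))
                 (iso_fwd (Lassoc M (tensmod N P) Q)))
          (Ltens (iso_fwd (Lassoc M N P)) (Lid Q)).
Proof.
apply: Lhom_eq => /=.
rewrite (idmx_tensl _ (congr1 (muln^~ (dim Q)) (idmx_assoc _ _ _))).
rewrite (idmx_tensr _ (congr1 (muln (dim M)) (idmx_assoc _ _ _))).
by rewrite !idmxM; congr idmx; apply: eq_irrelevance.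
Qed.
Fact Ltriangle (M N : Lmod) :
  Lcomp (Ltens (Lid M) (iso_fwd (Llunit N))) (iso_fwd (Lassoc M (unitmod k) N))
  = Ltens (iso_fwd (Lrunit M)) (Lid N).
Proof.
apply: Lhom_eq => /=.
rewrite (idmx_tensl _ (congr1 (muln^~ (dim N)) (muln1 _))).
rewrite (idmx_tensr _ (congr1 (muln (dim M)) (mul1n _))).
by rewrite !idmxM; congr idmx; apply: eq_irrelevance.
Qed.

Definition repL : monoidal_category :=
  @MonoidalCategory repL_cat (@tensmod k) Ltens (unitmod k) Lassoc Llunit Lrunit
    Ltens_id Ltens_comp Lassoc_nat Llunit_nat Lrunit_nat Lpentagon Ltriangle.

Definition Liso (M N : Lmod) : Prop := inhabited (cat_iso (M : repL) (N : repL)).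

Inductive in_family (M : Lmod) : Prop :=
| InFamily_K (a : k) (a0 : a != 0) of Liso M (Kmod a0)
| InFamily_U (a b : k) (a0 : a != 0) (b0 : b != 0) of Liso M (Umod b a0)
| InFamily_W (a : k) (a0 : a != 0) of Liso M (Wmod a0).

(* [n = 0] gives the zero module. *)
Definition is_dsum_of (F : Lmod -> Prop) (M : Lmod) : Prop :=
  exists (n : nat) (N : 'I_n -> Lmod),
    (forall i, F (N i)) /\ Liso M (bigdsum [seq N i | i <- enum 'I_n]).

Definition rep_family (F : Lmod -> Prop) : subcategory repL :=
  full_subcategory (C := repL) (is_dsum_of F).

End Rep.

(* Main.v *)
(* The tensor product distributes over direct sums, so it suffices to decompose
   the product of two modules of the family.  A one-dimensional factor only
   rescales the other one.  For M and N of dimension 2, let y^2 act on them by the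
   scalars u and v, and g^2 act on M by a^2.  Since y (x) 1 and g (x) y
   anticommute, y^2 acts on M (x) N by the scalar c = u + a^2 v.  If c != 0, then
   M (x) N is a sum of two modules U; if c = 0, then y has rank 1 on each eigenspace
   of g, and M (x) N is a sum of two modules W. *)

From mathcomp Require Import all_boot all_algebra.
From mathcomp Require Import mxtens ring.
Require Import Defs.

Set Implicit Arguments.
Unset Strict Implicit.
Unset Printing Implicit Defensive.

Import GRing.Theory.
Local Open Scope ring_scope.

(** * Isomorphisms, direct sums and distributivity *)

Section Isomorphisms.
Variable k : fieldType.
Implicit Types M N P : Lmod k.

(** The inverse of an intertwining matrix intertwines as well, so only [F] has to be checked. *)
Lemma Liso_mx M N (F : 'M[k]_(dim N, dim M)) (G : 'M[k]_(dim M, dim N)) :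
  is_Lhom (M := M) (N := N) F -> G *m F = 1%:M -> F *m G = 1%:M -> Liso M N.
Proof.
move=> hF GF FG.
have hG : is_Lhom (M := N) (N := M) G.
  by move=> x; rewrite -[LHS]mulmx1 -FG mulmxA -(mulmxA G) -hF mulmxA GF mul1mx.
by constructor; exists (LHom hF : @cat_hom (repL_cat k) M N)
  (LHom hG : @cat_hom (repL_cat k) N M); apply: Lhom_eq.
Qed.

Lemma LisoP M N : Liso M N -> exists (F : Lhom M N) (G : Lhom N M),
  Lhom_mx G *m Lhom_mx F = 1%:M /\ Lhom_mx F *m Lhom_mx G = 1%:M.
Proof.
case=> -[F G GF FG]; exists F, G.
by split; [apply: (congr1 (@Lhom_mx _ _ _) GF) | apply: (congr1 (@Lhom_mx _ _ _) FG)].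
Qed.

Lemma Liso_refl M : Liso M M.
Proof.
by apply: (Liso_mx (F := 1%:M) (G := 1%:M) (@Lid_proof k M)); rewrite mulmx1.
Qed.

Lemma Liso_sym M N : Liso M N -> Liso N M.
Proof. by case/LisoP=> F [G [GF FG]]; apply: (Liso_mx (LhomP G) FG GF). Qed.

Lemma Liso_trans M N P : Liso M N -> Liso N P -> Liso M P.
Proof.
case/LisoP=> F [G [GF FG]] /LisoP[F' [G' [GF' FG']]].
apply: (Liso_mx (G := Lhom_mx G *m Lhom_mx G') (LhomP (Lcomp F' F))) => /=.
  by rewrite mulmxA -(mulmxA (Lhom_mx G)) GF' mulmx1.
by rewrite mulmxA -(mulmxA (Lhom_mx F')) FG mulmx1.
Qed.

Lemma Liso_tens M M' N N' :
  Liso M M' -> Liso N N' -> Liso (tensmod M N) (tensmod M' N').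
Proof.
case/LisoP=> F [G [GF FG]] /LisoP[F' [G' [GF' FG']]].
apply: (Liso_mx (M := tensmod M N) (N := tensmod M' N')
  (G := Lhom_mx G *t Lhom_mx G') (LhomP (Ltens F F'))) => /=;
by rewrite tensmx_mul ?GF ?GF' ?FG ?FG' tensmx11.
Qed.

(** Equations between morphisms characterise a direct sum; in this form it survives any additive
    functor, such as tensoring with a fixed module. *)
Lemma Liso_dsum_biproduct M N P (i : Lhom N M) (j : Lhom P M) (p : Lhom M N)
    (q : Lhom M P) :
    Lhom_mx p *m Lhom_mx i = 1%:M -> Lhom_mx p *m Lhom_mx j = 0 ->
    Lhom_mx q *m Lhom_mx i = 0 -> Lhom_mx q *m Lhom_mx j = 1%:M ->
    Lhom_mx i *m Lhom_mx p + Lhom_mx j *m Lhom_mx q = 1%:M ->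
  Liso M (dsum N P).
Proof.
move=> pi pj qi qj ij.
apply: (Liso_mx (F := col_mx (Lhom_mx p) (Lhom_mx q) : 'M_(dim (dsum N P), _))
  (G := row_mx (Lhom_mx i) (Lhom_mx j))) => [x||].
- by rewrite mul_col_mx !LhomP /= /dsum_fun mul_block_col !mul0mx addr0 add0r.
- by rewrite mul_row_col.
- by rewrite mul_col_row pi pj qi qj -scalar_mx_block.
Qed.

(* The dimension condition makes the one-sided inverse two-sided. *)
Lemma Liso_dsum_span M N P (F : 'M[k]_(dim M, dim N)) (F' : 'M[k]_(dim M, dim P))
    (G : 'M[k]_(dim N, dim M)) (G' : 'M[k]_(dim P, dim M)) :
    dim M = (dim N + dim P)%N ->
    is_Lhom (M := N) (N := M) F -> is_Lhom (M := P) (N := M) F' ->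
    F *m G + F' *m G' = 1%:M ->
  Liso M (dsum N P).
Proof.
move=> dM hF hF' FG; apply: Liso_sym.
have RC : row_mx F F' *m col_mx G G' = 1%:M by rewrite mul_row_col.
apply: (Liso_mx (M := dsum N P) (F := row_mx F F') (G := col_mx G G')) => // [x|].
  by rewrite /= /dsum_fun mul_row_block !mulmx0 addr0 add0r mul_mx_row hF hF'.
have conv p q (A : 'M[k]_(p, q)) (B : 'M[k]_(q, p)) :
    p = q -> A *m B = 1%:M -> B *m A = 1%:M.
  by move=> e; case: q / e A B => A B; apply: mulmx1C.
exact: conv dM RC.
Qed.

(** The four structure maps are transparent: the identities [dsumK] compute with their matrices. *)
Definition dsum_inl M N : Lhom M (dsum M N).
Proof.
apply: (@LHom k M (dsum M N) (col_mx 1%:M 0)) => x.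
by rewrite /= /dsum_fun mul_block_col mul_col_mx !mul1mx !mulmx1 !mul0mx !mulmx0
  !addr0.
Defined.

Definition dsum_inr M N : Lhom N (dsum M N).
Proof.
apply: (@LHom k N (dsum M N) (col_mx 0 1%:M)) => x.
by rewrite /= /dsum_fun mul_block_col mul_col_mx !mul1mx !mulmx1 !mul0mx !mulmx0
  !add0r.
Defined.

Definition dsum_prl M N : Lhom (dsum M N) M.
Proof.
apply: (@LHom k (dsum M N) M (row_mx 1%:M 0)) => x.
by rewrite /= /dsum_fun mul_row_block mul_mx_row !mul1mx !mulmx1 !mul0mx !mulmx0
  !addr0.
Defined.

Definition dsum_prr M N : Lhom (dsum M N) N.
Proof.
apply: (@LHom k (dsum M N) N (row_mx 0 1%:M)) => x.
by rewrite /= /dsum_fun mul_row_block mul_mx_row !mul1mx !mulmx1 !mul0mx !mulmx0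
  !add0r.
Defined.

Lemma dsum_prl_inl M N :
  Lhom_mx (dsum_prl M N) *m Lhom_mx (dsum_inl M N) = 1%:M.
Proof. by rewrite /= mul_row_col mulmx1 mul0mx addr0. Qed.
Lemma dsum_prl_inr M N : Lhom_mx (dsum_prl M N) *m Lhom_mx (dsum_inr M N) = 0.
Proof. by rewrite /= mul_row_col mulmx0 mul0mx addr0. Qed.
Lemma dsum_prr_inl M N : Lhom_mx (dsum_prr M N) *m Lhom_mx (dsum_inl M N) = 0.
Proof. by rewrite /= mul_row_col mulmx0 mul0mx addr0. Qed.
Lemma dsum_prr_inr M N :
  Lhom_mx (dsum_prr M N) *m Lhom_mx (dsum_inr M N) = 1%:M.
Proof. by rewrite /= mul_row_col mulmx1 mul0mx add0r. Qed.
Lemma dsum_in_pr M N :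
  Lhom_mx (dsum_inl M N) *m Lhom_mx (dsum_prl M N)
  + Lhom_mx (dsum_inr M N) *m Lhom_mx (dsum_prr M N) = 1%:M.
Proof.
rewrite /= !mul_col_row !mulmx1 !mulmx0 add_block_mx !addr0 !add0r.
by rewrite -scalar_mx_block.
Qed.
Definition dsumK :=
  (dsum_prl_inl, dsum_prl_inr, dsum_prr_inl, dsum_prr_inr, dsum_in_pr).

(** Tensoring with [Lid N] preserves sums, composites and identities of morphisms, hence carries the
    equations [dsumK] to those of a direct sum. *)
Lemma tensmod_dsuml M M' N :
  Liso (tensmod (dsum M M') N) (dsum (tensmod M N) (tensmod M' N)).
Proof.
apply: (Liso_dsum_biproduct (i := Ltens (dsum_inl M M') (Lid N))
  (j := Ltens (dsum_inr M M') (Lid N)) (p := Ltens (dsum_prl M M') (Lid N))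
  (q := Ltens (dsum_prr M M') (Lid N))).
1-4: by rewrite [LHS]tensmx_mul dsumK mulmx1 ?tensmx11 ?tens0mx.
by rewrite [X in X + _]tensmx_mul [X in _ + X]tensmx_mul -tensmxDl dsumK mulmx1
  tensmx11.
Qed.

Lemma tensmod_dsumr M N N' :
  Liso (tensmod M (dsum N N')) (dsum (tensmod M N) (tensmod M N')).
Proof.
apply: (Liso_dsum_biproduct (i := Ltens (Lid M) (dsum_inl N N'))
  (j := Ltens (Lid M) (dsum_inr N N')) (p := Ltens (Lid M) (dsum_prl N N'))
  (q := Ltens (Lid M) (dsum_prr N N'))).
1-4: by rewrite [LHS]tensmx_mul dsumK mulmx1 ?tensmx11 ?tensmx0.
by rewrite [X in X + _]tensmx_mul [X in _ + X]tensmx_mul -tensmxDr dsumK mulmx1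
  tensmx11.
Qed.

Lemma Liso_dsum M M' N N' : Liso M M' -> Liso N N' -> Liso (dsum M N) (dsum M' N').
Proof.
case/LisoP=> F [G [GF FG]] /LisoP[F' [G' [GF' FG']]].
apply: (Liso_mx (M := dsum M N) (N := dsum M' N')
  (F := block_mx (Lhom_mx F) 0 0 (Lhom_mx F'))
  (G := block_mx (Lhom_mx G) 0 0 (Lhom_mx G'))) => [x||].
  by rewrite /= /dsum_fun !mulmx_block !mul0mx !mulmx0 !addr0 !add0r !LhomP.
all: by rewrite mulmx_block !mul0mx !mulmx0 !addr0 !add0r ?GF ?GF' ?FG ?FG'
  -scalar_mx_block.
Qed.

(** The two actions differ only in the bracketing of the dimension, so a cast identity matrix is an
    isomorphism. *)
Lemma dsumA M N P : Liso (dsum (dsum M N) P) (dsum M (dsum N P)).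
Proof.
have cast x : castmx (esym (addnA (dim M) (dim N) (dim P)),
    esym (addnA (dim M) (dim N) (dim P))) (dsum (dsum M N) P x)
    = dsum M (dsum N P) x.
  (* The zero blocks are split to reach the three-by-three form of [block_mxA]. *)
  by rewrite /= /dsum_fun -[in LHS]row_mx0 -[in LHS]col_mx0 -block_mxA row_mx0
    col_mx0.
constructor; exact: (idiso (M := dsum (dsum M N) P) (N := dsum M (dsum N P))
  (cast Ly) (cast Lg)).
Qed.

Lemma Liso_dim0 M N : dim M = 0%N -> dim N = 0%N -> Liso M N.
Proof.
have flat0 p q (A B : 'M[k]_(p, q)) : p = 0%N -> A = B.
  by move=> p0; apply/matrixP=> i; have := ltn_ord i; rewrite {2}p0.
move=> M0 N0.
by apply: (Liso_mx (F := 0) (G := 0)) => [x||]; apply: flat0.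
Qed.

Lemma dsum0l M : Liso (dsum (zeromod k) M) M.
Proof.
apply: (Liso_mx (LhomP (dsum_prr (zeromod k) M))
  (G := Lhom_mx (dsum_inr (zeromod k) M))); rewrite ?dsumK //.
rewrite -[RHS]dsum_in_pr [X in X + _](_ : _ = 0) ?add0r //.
(* The projection to [zeromod] has no rows. *)
by rewrite [Lhom_mx (dsum_prl _ _)](_ : _ = 0) ?mulmx0 //; apply/matrixP=> -[].
Qed.
End Isomorphisms.

(** * Direct sums of members of a family *)

Section DirectSums.
Variables (k : fieldType) (F : Lmod k -> Prop).
Implicit Types M N P : Lmod k.

Lemma is_dsum_of_iso M N : Liso M N -> is_dsum_of F N -> is_dsum_of F M.
Proof.
by move=> MN [n [N_ [FN iN]]]; exists n, N_; split=> //; apply: Liso_trans iN.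
Qed.

Lemma is_dsum_of0 : is_dsum_of F (zeromod k).
Proof.
exists 0%N, (fun _ => zeromod k); split=> [[]//|].
by rewrite enum_ord0; apply: Liso_refl.
Qed.

Lemma is_dsum_of_cons M N : F M -> is_dsum_of F N -> is_dsum_of F (dsum M N).
Proof.
move=> FM [n [N_ [FN iN]]].
exists n.+1, (fun i => if unlift ord0 i is Some j then N_ j else M); split.
  by move=> i; case: unliftP.
rewrite enum_ordSl /= unlift_none -map_comp (eq_map (g := N_)) => [|i /=].
  by apply: Liso_dsum iN; apply: Liso_refl.
by rewrite liftK.
Qed.

(** Replaces indexed families of summands by an induction that adds one summand at a time. *)
Lemma is_dsum_of_ind (P : Lmod k -> Prop) :
    (forall M N, Liso M N -> P N -> P M) -> P (zeromod k) ->
    (forall M N, F M -> P N -> P (dsum M N)) ->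
  forall M, is_dsum_of F M -> P M.
Proof.
move=> Piso P0 PD M [n [N_ [FN iM]]]; apply: Piso iM _.
(* The list is generalised, as the tail of [enum 'I_n] is not an enumeration. *)
by elim: (enum _) => //= i s IHs; apply: PD.
Qed.

Lemma is_dsum_of1 M : F M -> is_dsum_of F M.
Proof.
move=> FM; apply: is_dsum_of_iso (is_dsum_of_cons FM is_dsum_of0).
apply: Liso_sym; apply: (Liso_mx (LhomP (dsum_prl M (zeromod k)))
  (G := Lhom_mx (dsum_inl M (zeromod k)))); rewrite ?dsumK //.
rewrite -[RHS]dsum_in_pr [X in _ + X](_ : _ = 0) ?addr0 //.
by rewrite [Lhom_mx (dsum_prr _ _)](_ : _ = 0) ?mulmx0 //; apply/matrixP=> -[].
Qed.

Lemma is_dsum_of_dsum M N :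
  is_dsum_of F M -> is_dsum_of F N -> is_dsum_of F (dsum M N).
Proof.
move=> FM FN; elim/is_dsum_of_ind: M / FM => [M M' MM'||M M' FM FM'].
- by apply: is_dsum_of_iso; apply: Liso_dsum => //; apply: Liso_refl.
- by apply: is_dsum_of_iso FN; apply: dsum0l.
- by apply: is_dsum_of_iso (dsumA _ _ _) _; apply: is_dsum_of_cons.
Qed.

Lemma is_dsum_of_tens :
    (forall M N, F M -> F N -> is_dsum_of F (tensmod M N)) ->
  forall M N, is_dsum_of F M -> is_dsum_of F N -> is_dsum_of F (tensmod M N).
Proof.
move=> FT M N FM FN; elim/is_dsum_of_ind: M / FM => [M M' MM'||M M' FM FM'].
- by apply: is_dsum_of_iso; apply: Liso_tens => //; apply: Liso_refl.
- by apply: is_dsum_of_iso is_dsum_of0; apply: Liso_dim0.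
apply: is_dsum_of_iso (tensmod_dsuml _ _ _) _; apply: is_dsum_of_dsum FM'.
(* The first factor is now a single member of [F]; the second one is decomposed in turn. *)
elim/is_dsum_of_ind: N / FN => [N N' NN'||N N' FN FN'].
- by apply: is_dsum_of_iso; apply: Liso_tens => //; apply: Liso_refl.
- by apply: is_dsum_of_iso is_dsum_of0; apply: Liso_dim0; rewrite //= muln0.
by apply: is_dsum_of_iso (tensmod_dsumr _ _ _) _; apply: is_dsum_of_dsum FN';
  apply: FT.
Qed.
End DirectSums.

(** * Tensor products of the modules K, U and W *)

Section TensorProducts.
Variable k : fieldType.

Definition mxseq m n (s : seq (seq k)) : 'M[k]_(m, n) :=
  \matrix_(i < m, j < n) nth 0 (nth [::] s i) j.

(** [mxtens_index] is lexicographic, so the basis is ordered e1 (x) e1, e1 (x) e2, e2 (x) e1, e2 (x)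
    e2. *)
Lemma tensmx22 (a b c d a' b' c' d' : k) :
  mx2 a b c d *t mx2 a' b' c' d' = mxseq 4 4
    [:: [:: a * a'; a * b'; b * a'; b * b'];
        [:: a * c'; a * d'; b * c'; b * d'];
        [:: c * a'; c * b'; d * a'; d * b'];
        [:: c * c'; c * d'; d * c'; d * d']].
Proof.
apply/matrixP=> -[[|[|[|[|//]]]] ?] [[|[|[|[|//]]]] ?];
by rewrite !mxE /= /divn /modn.
Qed.

Lemma mx2_1 : 1%:M = mx2 (1 : k) 0 0 1.
Proof. by apply/matrixP=> -[[|[|//]] ?] [[|[|//]] ?]; rewrite !mxE. Qed.

Lemma tensmx_scalarl (a x y z t : k) :
  (a%:M : 'M_1) *t mx2 x y z t = mx2 (a * x) (a * y) (a * z) (a * t).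
Proof.
by apply/matrixP=> -[[|[|//]] ?] [[|[|//]] ?]; rewrite !mxE.
Qed.

Lemma tensmx_scalarr (a x y z t : k) :
  mx2 x y z t *t (a%:M : 'M_1) = mx2 (a * x) (a * y) (a * z) (a * t).
Proof.
by apply/matrixP=> -[[|[|//]] ?] [[|[|//]] ?]; rewrite !mxE /= mulrC.
Qed.

(** Serves all sizes up to 4: for smaller ones the surplus cases are absurd. *)
Local Ltac mx_entries :=
  apply/matrixP=> -[[|[|[|[|//]]]] ?] [[|[|[|[|//]]]] ?] //;
  do 2 rewrite ?mxE ?big_ord_recr ?big_ord0 /= ?mxE /=.

(** * Two factors of dimension two *)

Section TwoByTwo.
(* The modules U and W are the cases (b, d) = (b, 1) and (b, d) = (1, 0). *)
Variables (a b d a' b' d' : k) (a0 : a != 0) (a0' : a' != 0).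
Hypothesis r : mx2 a 0 0 (- a) *m mx2 0 b d 0 = - (mx2 0 b d 0 *m mx2 a 0 0 (- a)).
Hypothesis r' : mx2 a' 0 0 (- a') *m mx2 0 b' d' 0
  = - (mx2 0 b' d' 0 *m mx2 a' 0 0 (- a')).
Local Notation M := (modmx (UWmod_unit a0) r).
Local Notation N := (modmx (UWmod_unit a0') r').
(* The scalar by which y^2 acts on the tensor product. *)
Local Notation c := (b * d + a ^+ 2 * (b' * d')).

Local Ltac Lhom_entries :=
  apply: is_Lhom_gen;
  rewrite ?tensmod_g ?tensmod_y !modmx_g ?modmx_y ?mx2_1 !tensmx22; mx_entries.

(* Each copy of U is spanned by e and y e, for e = e1 (x) e1 and e = e2 (x) e2. *)
Lemma tensmod_UU (aa0 : a * a' != 0) : c != 0 ->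
  Liso (tensmod M N) (dsum (Umod c aa0) (Umod c aa0)).
Proof.
move=> c0.
apply: (Liso_dsum_span (M := tensmod M N) (N := Umod c aa0) (P := Umod c aa0)
  (F := mxseq 4 2 [:: [:: 1; 0]; [:: 0; a * d']; [:: 0; d]; [:: 0; 0]])
  (F' := mxseq 4 2 [:: [:: 0; 0]; [:: 0; b]; [:: 0; - (a * b')]; [:: 1; 0]])
  (G := mxseq 2 4 [:: [:: 1; 0; 0; 0]; [:: 0; a * b' / c; b / c; 0]])
  (G' := mxseq 2 4 [:: [:: 0; 0; 0; 1]; [:: 0; d / c; - (a * d' / c); 0]])) => //.
- by Lhom_entries; ring.
- by Lhom_entries; ring.
(* The two vectors y e lie in the span of e1 (x) e2 and e2 (x) e1, with determinant -c there; hence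
   the denominators. *)
- by mx_entries; field; rewrite ?c0.
Qed.

(** The entries that are not polynomial identities compare 0, from y^2 = 0 on W, with y^2 e = c
    e. *)
Local Ltac ring_c0 c0 :=
  first [ring | transitivity (c : k); [by rewrite c0; ring | by ring]
    | transitivity (- (c : k)); [by rewrite c0; ring | by ring]].

(* The copies of W are spanned by e and y e, for e = e1 (x) e2 and e = e1 (x) e1. *)
Lemma tensmod_WW_d (aa0 : a * a' != 0) (Naa0 : - (a * a') != 0) :
  c = 0 -> d != 0 -> Liso (tensmod M N) (dsum (Wmod aa0) (Wmod Naa0)).
Proof.
move=> c0 d0.
(* The columns are y e, then e, as y sends the second basis vector of W to the first. The coordinate
   d of y e makes the change of basis invertible. *)
apply: (Liso_dsum_span (M := tensmod M N) (N := Wmod aa0) (P := Wmod Naa0)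
  (F := mxseq 4 2 [:: [:: a * b'; 0]; [:: 0; 1]; [:: 0; 0]; [:: d; 0]])
  (F' := mxseq 4 2 [:: [:: 0; 1]; [:: a * d'; 0]; [:: d; 0]; [:: 0; 0]])
  (G := mxseq 2 4 [:: [:: 0; 0; 0; d^-1]; [:: 0; 1; - (a * d' / d); 0]])
  (G' := mxseq 2 4 [:: [:: 0; 0; d^-1; 0]; [:: 1; 0; 0; - (a * b' / d)]])) => //.
- by Lhom_entries; ring_c0 c0.
- by Lhom_entries; ring_c0 c0.
- by mx_entries; field; rewrite ?d0.
Qed.

(* Same with e = e2 (x) e1 and e = e2 (x) e2. *)
Lemma tensmod_WW_b (aa0 : a * a' != 0) (Naa0 : - (a * a') != 0) :
  c = 0 -> b != 0 -> Liso (tensmod M N) (dsum (Wmod aa0) (Wmod Naa0)).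
Proof.
move=> c0 b0.
apply: (Liso_dsum_span (M := tensmod M N) (N := Wmod aa0) (P := Wmod Naa0)
  (F := mxseq 4 2 [:: [:: b; 0]; [:: 0; 0]; [:: 0; 1]; [:: - (a * d'); 0]])
  (F' := mxseq 4 2 [:: [:: 0; 0]; [:: b; 0]; [:: - (a * b'); 0]; [:: 0; 1]])
  (G := mxseq 2 4 [:: [:: b^-1; 0; 0; 0]; [:: 0; a * b' / b; 1; 0]])
  (G' := mxseq 2 4 [:: [:: 0; b^-1; 0; 0]; [:: a * d' / b; 0; 0; 1]])) => //.
- by Lhom_entries; ring_c0 c0.
- by Lhom_entries; ring_c0 c0.
- by mx_entries; field; rewrite ?b0.
Qed.
End TwoByTwo.

(** * A factor of dimension one *)

Section OneDimensionalFactor.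
Variables (a a' : k) (a0 : a != 0) (a0' : a' != 0).

Lemma tensmod_KK (aa0 : a * a' != 0) :
  Liso (tensmod (Kmod a0) (Kmod a0')) (Kmod aa0).
Proof.
apply: (Liso_mx (M := tensmod (Kmod a0) (Kmod a0')) (N := Kmod aa0)
  (F := 1%:M) (G := 1%:M)); rewrite ?mulmx1 //.
apply: is_Lhom_gen; rewrite ?tensmod_g ?tensmod_y !modmx_g ?modmx_y.
  by rewrite tens0mx tensmx0 addr0 mulmx0 mul0mx.
by apply/matrixP=> i j; rewrite !ord1 mulmx1 mul1mx !mxE.
Qed.

(** By the term g (x) y of [Delta Ly], y acts as a times its matrix on U. Rescaling the first basis
    vector restores the entry 1 and turns b into a^2 b. *)
Lemma tensmod_KU (b : k) (aa0 : a * a' != 0) :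
  Liso (tensmod (Kmod a0) (Umod b a0')) (Umod (a ^+ 2 * b) aa0).
Proof.
apply: (Liso_mx (M := tensmod (Kmod a0) (Umod b a0')) (N := Umod (a ^+ 2 * b) aa0)
  (F := mx2 a 0 0 1) (G := mx2 a^-1 0 0 1)).
- apply: is_Lhom_gen; rewrite ?tensmod_g ?tensmod_y !modmx_g ?modmx_y ?tens0mx ?add0r
    tensmx_scalarl; mx_entries; ring.
- by mx_entries; field; rewrite ?a0.
- by mx_entries; field; rewrite ?a0.
Qed.

(** The factor a on y is absorbed by rescaling the second basis vector. *)
Lemma tensmod_KW (aa0 : a * a' != 0) :
  Liso (tensmod (Kmod a0) (Wmod a0')) (Wmod aa0).
Proof.
apply: (Liso_mx (M := tensmod (Kmod a0) (Wmod a0')) (N := Wmod aa0)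
  (F := mx2 1 0 0 a) (G := mx2 1 0 0 a^-1)).
- apply: is_Lhom_gen; rewrite ?tensmod_g ?tensmod_y !modmx_g ?modmx_y ?tens0mx ?add0r
    tensmx_scalarl; mx_entries; ring.
- by mx_entries; field; rewrite ?a0.
- by mx_entries; field; rewrite ?a0.
Qed.

(** Only y (x) 1 survives, as y kills the right factor: y keeps its matrix and g is scaled by a'. *)
Lemma tensmod_UK (b : k) (aa0 : a * a' != 0) :
  Liso (tensmod (Umod b a0) (Kmod a0')) (Umod b aa0).
Proof.
apply: (Liso_mx (M := tensmod (Umod b a0) (Kmod a0')) (N := Umod b aa0)
  (F := 1%:M) (G := 1%:M)); rewrite ?mulmx1 //.
apply: is_Lhom_gen; rewrite ?tensmod_g ?tensmod_y !modmx_g ?modmx_y ?tensmx0 ?addr0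
  tensmx_scalarr mulmx1 mul1mx; mx_entries; ring.
Qed.

Lemma tensmod_WK (aa0 : a * a' != 0) :
  Liso (tensmod (Wmod a0) (Kmod a0')) (Wmod aa0).
Proof.
apply: (Liso_mx (M := tensmod (Wmod a0) (Kmod a0')) (N := Wmod aa0)
  (F := 1%:M) (G := 1%:M)); rewrite ?mulmx1 //.
apply: is_Lhom_gen; rewrite ?tensmod_g ?tensmod_y !modmx_g ?modmx_y ?tensmx0 ?addr0
  tensmx_scalarr mulmx1 mul1mx; mx_entries; ring.
Qed.
End OneDimensionalFactor.

(** * Closure of the family *)

Local Notation sums := (is_dsum_of (@in_family k)).

Lemma sums_K (a : k) (a0 : a != 0) : sums (Kmod a0).
Proof. by apply: is_dsum_of1; apply: InFamily_K (Liso_refl _). Qed.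
Lemma sums_U (a b : k) (a0 : a != 0) : b != 0 -> sums (Umod b a0).
Proof. by move=> b0; apply: is_dsum_of1; apply: InFamily_U b0 (Liso_refl _). Qed.
Lemma sums_W (a : k) (a0 : a != 0) : sums (Wmod a0).
Proof. by apply: is_dsum_of1; apply: InFamily_W (Liso_refl _). Qed.

(** The scalar c is b for U (x) W and a^2 b' for W (x) U, hence nonzero; it is 0 for W (x) W; only U
    (x) U requires a case distinction. *)
Lemma in_family_tens (M N : Lmod k) :
  in_family M -> in_family N -> sums (tensmod M N).
Proof.
have UU (a a' b d b' d' : k) (a0 : a != 0) (a0' : a' != 0) r r' :
    b * d + a ^+ 2 * (b' * d') != 0 ->
    sums (tensmod (@modmx k 2 _ (mx2 0 b d 0) (UWmod_unit a0) r)
                  (@modmx k 2 _ (mx2 0 b' d' 0) (UWmod_unit a0') r')).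
  move=> c0; apply: is_dsum_of_iso (tensmod_UU a0 a0' r r' (mulf_neq0 a0 a0') c0) _.
  by apply: is_dsum_of_dsum; apply: sums_U.
have WW (a : k) (a0 : a != 0) (Na0 : - a != 0) : sums (dsum (Wmod a0) (Wmod Na0)).
  by apply: is_dsum_of_dsum; apply: sums_W.
have N0 (a : k) : a != 0 -> - a != 0 by rewrite oppr_eq0.
case=> [a a0|a b a0 b0|a a0] iM; case=> [a' a0'|a' b' a0' b0'|a' a0'] iN;
  apply: is_dsum_of_iso (Liso_tens iM iN) _; have aa0 := mulf_neq0 a0 a0'.
- exact: is_dsum_of_iso (tensmod_KK a0 a0' aa0) (sums_K _).
- apply: is_dsum_of_iso (tensmod_KU a0 a0' b' aa0) (sums_U _ _).
  by rewrite mulf_neq0 // expf_neq0.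
- exact: is_dsum_of_iso (tensmod_KW a0 a0' aa0) (sums_W _).
- exact: is_dsum_of_iso (tensmod_UK a0 a0' b aa0) (sums_U _ b0).
- have [c0|c0] := eqVneq (b * 1 + a ^+ 2 * (b' * 1)) 0; last exact: UU.
  have iW := tensmod_WW_d a0 a0' (Umod_rel _ _) (Umod_rel _ _) aa0 (N0 _ aa0) c0.
  exact: is_dsum_of_iso (iW (oner_neq0 k)) (WW _ _ _).
- by apply: UU; rewrite mulr1 mulr0 mulr0 addr0.
- exact: is_dsum_of_iso (tensmod_WK a0 a0' aa0) (sums_W _).
- by apply: UU; rewrite mulr0 mulr1 add0r mulf_neq0 // expf_neq0.
- have c0 : 1 * 0 + a ^+ 2 * (1 * 0) = 0 by rewrite !mulr0 addr0.
  (* Here d = 0 and b = 1, hence the variant [tensmod_WW_b]. *)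
  have iW := tensmod_WW_b a0 a0' (Wmod_rel _) (Wmod_rel _) aa0 (N0 _ aa0) c0.
  exact: is_dsum_of_iso (iW (oner_neq0 k)) (WW _ _ _).
Qed.

(** The counit sends g to 1 and y to 0, so the unit object is [Kmod] at 1. *)
Lemma sums_unit : sums (unitmod k).
Proof.
apply: is_dsum_of_iso (sums_K (oner_neq0 k)).
apply: (Liso_mx (M := unitmod k) (N := Kmod (oner_neq0 k)) (F := 1%:M) (G := 1%:M));
  rewrite ?mulmx1 //.
by apply: is_Lhom_gen; rewrite ?unitmod_y ?unitmod_g ?modmx_y ?modmx_g ?mulmx1 ?mul1mx.
Qed.
End TensorProducts.

Theorem proposition2p19 (k : closedFieldType) (k_char0 : [pchar k]%R =i pred0) :
  @is_monoidal_subcategory (repL k) (rep_family (@in_family k)).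
Proof.
have T := is_dsum_of_tens (@in_family_tens k).
(* The subcategory is full, so each condition on morphisms only asks that their sources and targets
   be sums. *)
split=> [|a b|a a' b b' f g|a b c|a|a] /=.
- exact: sums_unit.
- exact: T.
- by case=> Fa Fa' [Fb Fb']; split; apply: T.
- move=> Fa Fb Fc; have Tl := T _ _ (T _ _ Fa Fb) Fc.
  by have Tr := T _ _ Fa (T _ _ Fb Fc).
- by move=> Fa; have TF := T _ _ (sums_unit k) Fa.
- by move=> Fa; have TF := T _ _ Fa (sums_unit k).
Qed.
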